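(* Let $n\ge1$, and let $\boldsymbol t=(t_0,t_1)$, $\boldsymbol c=(c_0,\ldots,c_{2n+1})$, $\tau_3$ and the functions $\varphi_i(\boldsymbol t,\boldsymbol c)$ be as in the context. If we set $$\alpha=-t_1^{\frac1{n+1}},\quad \beta=-t_0^{-\frac1{n+1}},\quad \gamma=-t_0^{\frac1{n+1}},\quad \delta=-t_1^{-\frac1{n+1}},$$ $$c_{i,n-i+2k}=\frac{\tau_3^{-k}(c_{2i})}{q^{\frac1{n+1}}},\qquad c_{i,n-i+2k-1}=\frac1{\tau_3^{-k}(c_{2i+1})}\qquad(i,k=0,\ldots,n),$$ and $$f_{i,n-i+2k}=t_0^{\frac1{n+1}}\varphi_{2i}(\boldsymbol t,\tau_3^{-k}(\boldsymbol c)),\qquad g_{i,n-i+2k-1}=\frac{t_0^{-\frac1{n+1}}\varphi_{2i+1}(\boldsymbol t,\tau_3^{-k}(\boldsymbol c))}{\tau_3^{-k}(c_{2i+1})},$$ $$\overline f_{i,n-i+2k}=q^{\frac1{n+1}}t_0^{\frac1{n+1}}\varphi_{2i}(q\boldsymbol t,\tau_3^{-k}(\boldsymbol c)),\qquad \overline g_{i,n-i+2k-1}=\frac{q^{-\frac1{n+1}}t_0^{-\frac1{n+1}}\varphi_{2i+1}(q\boldsymbol t,\tau_3^{-k}(\boldsymbol c))}{\tau_3^{-k}(c_{2i+1})},$$ for $i,k=0,\ldots,n$ (double indices of $c,f,g$ being read modulo $n+1$), then they satisfy Tsuda's $q$-Painlevé system $$\overline f_{i,n-i+2k}=\frac{c_{i,n-i+2k}}{c_{i,n-i+2k+1}}\frac{(g_{i+1,n-i+2k}-\alpha)(g_{i,n-i+2k+1}-c_{i,n-i+2k+1}\beta)}{(g_{i,n-i+2k+1}-\alpha)(g_{i+1,n-i+2k}-c_{i+1,n-i+2k}\beta)}\,f_{i+1,n-i+2k+1},$$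 $$\overline g_{i,n-i+2k-1}=\frac{c_{i+1,n-i+2k-1}}{c_{i+1,n-i+2k}}\frac{(\overline f_{i+1,n-i+2k-1}-q^{\frac1{n+1}}\gamma)(\overline f_{i,n-i+2k}-c_{i,n-i+2k}\delta)}{(\overline f_{i,n-i+2k}-q^{\frac1{n+1}}\gamma)(\overline f_{i+1,n-i+2k-1}-c_{i+1,n-i+2k-1}\delta)}\,g_{i+1,n-i+2k},$$ together with the constraints $$\alpha\delta=\beta\gamma,\quad \frac{c_{i,n-i+2k}\,c_{i+1,n-i+2k+1}}{c_{i+1,n-i+2k}\,c_{i,n-i+2k+1}}=1,\quad \frac{c_{i,n-i+2k-1}\,c_{i+1,n-i+2k}}{c_{i+1,n-i+2k-1}\,c_{i,n-i+2k}}=1\quad(i,k=0,\ldots,n),$$ $$\prod_{i=0}^nf_{i,n-i+2k}=1,\qquad \prod_{i=0}^ng_{i,n-i+2k-1}=1\quad(k=0,\ldots,n).$$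
   Context: Let $\alpha_i,\varphi_i$ $(i\in\mathbb{Z}_{2n+2})$ be independent variables (single indices modulo $2n+2$), $q=\prod_{i=0}^{2n+1}\alpha_i$. Define birational transformations $$r_j(\alpha_j)=\alpha_j^{-1},\ r_j(\alpha_{j\pm1})=\alpha_{j\pm1}\alpha_j,\ r_j(\alpha_i)=\alpha_i\ (i\ne j,j\pm1),\quad r_j(\varphi_i)=\varphi_i\,\alpha_j^{-\delta_{i,j}+\delta_{i,j+1}}\Big(\tfrac{\alpha_j+\varphi_j}{1+\varphi_j}\Big)^{\delta_{i,j-1}-\delta_{i,j+1}},$$ $\pi(\alpha_i)=\alpha_{i+1}$, $\pi(\varphi_i)=\varphi_{i+1}$, composed from right to left as maps of tuples (as field automorphisms, $(fg)(x)=g(f(x))$), and $$\tau_3=(r_0r_2\cdots r_{2n}\,\pi)^2 .$$ Explicitly, for $i=0,\ldots,n$: $\tau_3(\alpha_{2i})=\frac1{\alpha_{2i+1}\alpha_{2i+2}\alpha_{2i+3}}$, $\tau_3(\alpha_{2i+1})=\alpha_{2i+1}\alpha_{2i+2}\alpha_{2i+3}\alpha_{2i+4}\alpha_{2i+5}$, and $$\tau_3(\varphi_{2i})=\frac1{\alpha_{2i+2}\alpha_{2i+3}}\frac{(1+\varphi_{2i+1})(\alpha_{2i+3}+\varphi_{2i+3})}{(1+\varphi_{2i+3})(\alpha_{2i+1}+\varphi_{2i+1})}\varphi_{2i+2},$$ $$\tau_3(\varphi_{2i+1})=\alpha_{2i+1}\alpha_{2i+2}\frac{\{1+\tau_3(\varphi_{2i+2})\}\{\frac1{\alpha_{2i+1}\alpha_{2i+2}\alpha_{2i+3}}+\tau_3(\varphi_{2i})\}}{\{1+\tau_3(\varphi_{2i})\}\{\frac1{\alpha_{2i+3}\alpha_{2i+4}\alpha_{2i+5}}+\tau_3(\varphi_{2i+2})\}}\varphi_{2i+3}.$$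 Put $t_0=\prod_{i=0}^n\frac1{\varphi_{2i}}$, $t_1=\prod_{i=0}^n\frac{\alpha_{2i+1}}{\varphi_{2i+1}}$, $\boldsymbol t=(t_0,t_1)$; then $\tau_3(\boldsymbol t)=q\boldsymbol t=(qt_0,qt_1)$. Put $\boldsymbol c=(c_0,\ldots,c_{2n+1})$ with $$c_{2i}=t_0^{\frac1{n+1}}t_1^{\frac1{n+1}}\alpha_{2i},\qquad c_{2i+1}=t_0^{-\frac1{n+1}}t_1^{-\frac1{n+1}}\alpha_{2i+1}\qquad(i=0,\ldots,n).$$ The action of $\tau_3$ on $\boldsymbol c$ (with $t_l^{\frac1{n+1}}\mapsto q^{\frac1{n+1}}t_l^{\frac1{n+1}}$) depends on $\boldsymbol c$ only: $\tau_3(c_{2i})=q^{\frac2{n+1}}/(c_{2i+1}c_{2i+2}c_{2i+3})$, $\tau_3(c_{2i+1})=q^{-\frac2{n+1}}c_{2i+1}c_{2i+2}c_{2i+3}c_{2i+4}c_{2i+5}$; it satisfies $\tau_3^m(\boldsymbol c)=\boldsymbol c$ if $n=2m-1$ and $\tau_3^{n+1}(\boldsymbol c)=\boldsymbol c$ if $n=2m$. $\tau_3^{-k}(c_j)$ denotes the $j$-th component of $\tau_3^{-k}(\boldsymbol c)$. The $\varphi_i$ are regarded as dependent variables $\varphi_i(\boldsymbol t,\boldsymbol c)$, i.e. functions of $(\boldsymbol t,\boldsymbol c)$ (with $\alpha_j$ recovered from $(\boldsymbol t,\boldsymbol c)$ by the formulas above) satisfying, at all the points involved (the orbits of $\boldsymbol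 t$ under $\boldsymbol t\mapsto q\boldsymbol t$ and of $\boldsymbol c$ under $\tau_3$), the constraints $\prod_i\varphi_{2i}=t_0^{-1}$, $\prod_i\varphi_{2i+1}=t_1^{-1}\prod_i\alpha_{2i+1}$ and the evolution $\varphi_i(q\boldsymbol t,\tau_3(\boldsymbol c))=\tau_3(\varphi_i(\boldsymbol t,\boldsymbol c))$, where the right-hand side is the explicit expression for $\tau_3(\varphi_i)$ evaluated at $(\boldsymbol t,\boldsymbol c)$. *)

(* Defs.v *)
From HB Require Import structures.
From mathcomp Require Import all_boot all_algebra ring.
Set Implicit Arguments.
Unset Strict Implicit.
Unset Printing Implicit Defensive.
Import GRing.Theory.
Local Open Scope ring_scope.

(* Plain MathComp: the maps below are rational maps evaluated at points with coordinates in an arbitrary field K. *)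

(* Z_{2n+2}; as 2n+2 >= 2, this is convertible to 'I_(2n+2). *)
Notation idx n := ('Z_(n.*2.+2)).

(* (2n+2)-tuples of scalars; finite functions, so that pointwise equal tuples
   are equal and a function of a tuple respects this. *)
Notation tup K n := ({ffun idx n -> K}).

Section BirationalAction.
Variables (K : fieldType) (n : nat).
Implicit Types (x : tup K n * tup K n) (i j : idx n) (a c : tup K n).

Definition kron i j : int := (i == j)%:R.

(* A point x = (alpha, phi) is mapped to the point whose coordinates are the
   values at x of r_j(alpha_i) and r_j(phi_i). *)
Definition r j x : tup K n * tup K n :=
  let al := x.1 in let ph := x.2 in
  ([ffun i => if i == j then (al j)^-1
              else if (i == j + 1) || (i == j - 1) then al i * al j
              else al i],
   [ffun i => ph i * al j ^ (- kron i j + kron i (j + 1))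
              * ((al j + ph j) / (1 + ph j))
                  ^ (kron i (j - 1) - kron i (j + 1))]).

Definition rot1 x : tup K n * tup K n :=
  ([ffun i => x.1 (i + 1)], [ffun i => x.2 (i + 1)]).

(* r_0 r_2 ... r_{2n} pi : the factor pi is applied to the point first. *)
Definition half_tau3 x : tup K n * tup K n :=
  foldr (fun l y => r (l.*2)%:R y) (rot1 x) (iota 0 n.+1).

Definition tau3 x : tup K n * tup K n := half_tau3 (half_tau3 x).

(* Throughout, s0, s1 and p are the chosen (n+1)-th roots of t_0, t_1 and q. *)
Definition c_of_alpha (s0 s1 : K) a : tup K n :=
  [ffun j : idx n => if odd j then s0^-1 * s1^-1 * a j else s0 * s1 * a j].

Definition alpha_of_c (s0 s1 : K) c : tup K n :=
  [ffun j : idx n => if odd j then s0 * s1 * c j else s0^-1 * s1^-1 * c j].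

(* The induced action of tau_3 on c; see tau3_c_of_alpha. *)
Definition tau3_c (p : K) c : tup K n :=
  [ffun j : idx n =>
     if odd j
     then p ^- 2 * (c j * c (j + 1) * c (j + 2%:R) * c (j + 3%:R) * c (j + 4%:R))
     else p ^+ 2 / (c (j + 1) * c (j + 2%:R) * c (j + 3%:R))].

(* The inverse of tau3_c on tuples without zero entry; see tau3_cK, tau3_cVK. *)
Definition tau3_cV (p : K) c : tup K n :=
  [ffun j : idx n =>
     if odd j
     then p ^+ 2 / (c (j - 1) * c (j - 2%:R) * c (j - 3%:R))
     else p ^- 2 * (c j * c (j - 1) * c (j - 2%:R) * c (j - 3%:R) * c (j - 4%:R))].

Definition tau3_c_exp (p : K) (k : int) c : tup K n :=
  match k with
  | Posz m => iter m (tau3_c p) c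
  | Negz m => iter m.+1 (tau3_cV p) c
  end.

End BirationalAction.

Section Facts.
Variables (K : fieldType) (n : nat).
Implicit Types (x : tup K n * tup K n) (i j : idx n) (a c : tup K n).

Lemma odd_idxD i j : odd (i + j)%R = odd i (+) odd j.
Proof.
have N : odd n.*2.+2 = false by rewrite /= odd_double.
by rewrite -oddD -(odd_mod (i + j)%N N).
Qed.

Lemma odd_idxN j : odd (- j)%R = odd j.
Proof.
have := odd_idxD (- j) j.
have -> : odd (- j + j)%R = false by rewrite addNr.
by case: (odd (- j)%R); case: (odd j).
Qed.

Lemma odd_idx_nat k : odd (k%:R : idx n) = odd k.
Proof.
have N : odd n.*2.+2 = false by rewrite /= odd_double.
by rewrite Zp_nat -[RHS](odd_mod k N).
Qed.

Lemma odd_idx1 : odd (1%R : idx n).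
Proof. by []. Qed.

Definition odd_idxE := (odd_idxD, odd_idxN, odd_idx_nat, odd_idx1).

Lemma tau3_cK (p : K) c : p != 0 -> (forall j, c j != 0) ->
  tau3_cV p (tau3_c p c) = c.
Proof.
move=> p0 c0; apply/ffunP => j; rewrite !ffunE !odd_idxE /=.
case: (odd j) => /=.
  have -> : j - 1 + 1 = j by ring.
  have -> : j - 1 + 2%:R = j + 1 by ring.
  have -> : j - 1 + 3%:R = j + 2%:R by ring.
  have -> : j - 3%:R + 1 = j - 2%:R by ring.
  have -> : j - 3%:R + 2%:R = j - 1 by ring.
  have -> : j - 3%:R + 3%:R = j by ring.
  have -> : j - 2%:R + 1 = j - 1 by ring.
  have -> : j - 2%:R + 2%:R = j by ring.
  have -> : j - 2%:R + 3%:R = j + 1 by ring.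
  have -> : j - 2%:R + 4%:R = j + 2%:R by ring.
  by field; rewrite ?p0 ?c0.
have -> : j - 1 + 1 = j by ring.
have -> : j - 1 + 2%:R = j + 1 by ring.
have -> : j - 1 + 3%:R = j + 2%:R by ring.
have -> : j - 1 + 4%:R = j + 3%:R by ring.
have -> : j - 3%:R + 1 = j - 2%:R by ring.
have -> : j - 3%:R + 2%:R = j - 1 by ring.
have -> : j - 3%:R + 3%:R = j by ring.
have -> : j - 3%:R + 4%:R = j + 1 by ring.
have -> : j - 2%:R + 1 = j - 1 by ring.
have -> : j - 2%:R + 2%:R = j by ring.
have -> : j - 2%:R + 3%:R = j + 1 by ring.
have -> : j - 4%:R + 1 = j - 3%:R by ring.
have -> : j - 4%:R + 2%:R = j - 2%:R by ring.
have -> : j - 4%:R + 3%:R = j - 1 by ring.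
by field; rewrite ?p0 ?c0.
Qed.

Lemma tau3_cVK (p : K) c : p != 0 -> (forall j, c j != 0) ->
  tau3_c p (tau3_cV p c) = c.
Proof.
move=> p0 c0; apply/ffunP => j; rewrite !ffunE !odd_idxE /=.
case: (odd j) => /=.
  have -> : j + 1 - 1 = j by ring.
  have -> : j + 1 - 2%:R = j - 1 by ring.
  have -> : j + 1 - 3%:R = j - 2%:R by ring.
  have -> : j + 1 - 4%:R = j - 3%:R by ring.
  have -> : j + 2%:R - 1 = j + 1 by ring.
  have -> : j + 2%:R - 2%:R = j by ring.
  have -> : j + 2%:R - 3%:R = j - 1 by ring.
  have -> : j + 3%:R - 1 = j + 2%:R by ring.
  have -> : j + 3%:R - 2%:R = j + 1 by ring.
  have -> : j + 3%:R - 3%:R = j by ring.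
  have -> : j + 3%:R - 4%:R = j - 1 by ring.
  have -> : j + 4%:R - 1 = j + 3%:R by ring.
  have -> : j + 4%:R - 2%:R = j + 2%:R by ring.
  have -> : j + 4%:R - 3%:R = j + 1 by ring.
  by field; rewrite ?p0 ?c0.
have -> : j + 1 - 1 = j by ring.
have -> : j + 1 - 2%:R = j - 1 by ring.
have -> : j + 1 - 3%:R = j - 2%:R by ring.
have -> : j + 2%:R - 1 = j + 1 by ring.
have -> : j + 2%:R - 2%:R = j by ring.
have -> : j + 2%:R - 3%:R = j - 1 by ring.
have -> : j + 2%:R - 4%:R = j - 2%:R by ring.
have -> : j + 3%:R - 1 = j + 2%:R by ring.
have -> : j + 3%:R - 2%:R = j + 1 by ring.
have -> : j + 3%:R - 3%:R = j by ring.
by field; rewrite ?p0 ?c0.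
Qed.

Lemma alpha_of_cK (s0 s1 : K) c : s0 != 0 -> s1 != 0 ->
  c_of_alpha s0 s1 (alpha_of_c s0 s1 c) = c.
Proof.
move=> s0n s1n; apply/ffunP => j; rewrite !ffunE.
by case: (odd j); field; rewrite s0n s1n.
Qed.

Lemma c_of_alphaK (s0 s1 : K) a : s0 != 0 -> s1 != 0 ->
  alpha_of_c s0 s1 (c_of_alpha s0 s1 a) = a.
Proof.
move=> s0n s1n; apply/ffunP => j; rewrite !ffunE.
by case: (odd j); field; rewrite s0n s1n.
Qed.

Hypothesis hn : (1 <= n)%N.

Lemma idx12_neq j :
  (j == j + 1) = false /\ (j - 1 == j + 1) = false /\ (j + 1 == j - 1) = false.
Proof.
have H k : (0 < k < n.*2.+2)%N -> (k%:R : idx n) != 0.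
  move=> kN; apply/eqP => /(congr1 (@nat_of_ord _)).
  by rewrite Zp_nat /= modn_small; case/andP: kN => // + _; case: k.
have h1 := H 1%N isT. 
have h2 : (2%:R : idx n) != 0 by apply: H; rewrite /= !ltnS double_gt0.
have e1 : (j - 1 == j + 1) = false.
  apply/negbTE/eqP => /(congr1 (fun z => z - j + 1)) e; case/eqP: h2.
  by transitivity (j + 1 - j + 1); [ring | rewrite -e; ring].
split; [|split] => //; last by rewrite eq_sym.
apply/negbTE/eqP => /(congr1 (fun z => z - j)) e; case/eqP: h1.
by transitivity (j + 1 - j); [ring | rewrite -e; ring].
Qed.

Lemma fold_rE (s : seq (idx n)) x : uniq s -> all (fun j => ~~ odd j) s ->
  foldr (fun j y => r j y) x s =
  ([ffun i : idx n => if odd i then x.1 i * (if i - 1 \in s then x.1 (i - 1) else 1)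
                                  * (if i + 1 \in s then x.1 (i + 1) else 1)
              else if i \in s then (x.1 i)^-1 else x.1 i],
   [ffun i : idx n => if odd i then x.2 i *
     (if i - 1 \in s then x.1 (i-1) * ((1 + x.2 (i-1)) / (x.1 (i-1) + x.2 (i-1))) else 1) *
     (if i + 1 \in s then (x.1 (i+1) + x.2 (i+1)) / (1 + x.2 (i+1)) else 1)
     else if i \in s then x.2 i / x.1 i else x.2 i]).
Proof.
elim: s => [|j s IH] /=.
  move=> _ _; case: x => a b; congr pair; apply/ffunP => i; by rewrite ffunE /= !mulr1 if_same.
case/andP => js us /andP[oj os]; rewrite IH //.
have E i : odd i -> (i == j) = false.
  by move=> oi; apply/negbTE/eqP => e; move: oi; rewrite e (negbTE oj).
have E1 i : ~~ odd i -> (i == j + 1) = false.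
  move=> oi; apply/negbTE/eqP => e; move: oi; rewrite e odd_idxD (negbTE oj); exact/negP.
have E2 i : ~~ odd i -> (i == j - 1) = false.
  move=> oi; apply/negbTE/eqP => e; move: oi; rewrite e odd_idxD odd_idxN (negbTE oj); exact/negP.
have F1 i : (i - 1 == j) = (i == j + 1) by rewrite subr_eq.
have F2 i : (i + 1 == j) = (i == j - 1) by rewrite -(inj_eq (addIr (-1))) addrK.
have [G1 [G2 G3]] := idx12_neq j.
congr pair; apply/ffunP => i; rewrite !ffunE !inE F1 F2 (negbTE oj) (negbTE js) /kron.
  case: (boolP (odd i)) => oi.
    rewrite (E i oi).
    case: (eqVneq i (j + 1)) => [->|ij1].
      by rewrite G3 addrK (negbTE js) /= mulr1 mulrAC.
    case: (eqVneq i (j - 1)) => [->|ij2] //.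
    by rewrite addrNK (negbTE js) /= mulr1.
  by rewrite (E1 i oi) (E2 i oi); case: (eqVneq i j) => [->|//]; rewrite (negbTE js).
have k0 : (false%:R : int) = 0 by [].
have k1 : (true%:R : int) = 1 by [].
case: (boolP (odd i)) => oi.
  rewrite (E i oi) k0 oppr0 add0r.
  case: (eqVneq i (j + 1)) => [->|ij1].
    rewrite G3 k0 k1 addrK (negbTE js) ?orTb ?orFb sub0r expr1z -invr_expz expr1z invf_div mulr1.
    by rewrite -!mulrA; congr (_ * _); rewrite [LHS]mulrC -!mulrA.
  rewrite k0 expr0z mulr1.
  case: (eqVneq i (j - 1)) => [->|ij2].
    by rewrite k1 addrNK (negbTE js) subr0 expr1z /= mulr1.
  by rewrite k0 subr0 expr0z mulr1.
rewrite (E1 i oi) (E2 i oi) k0 ?addr0 ?subr0 expr0z mulr1.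
case: (eqVneq i j) => [->|_]; last by rewrite k0 oppr0 expr0z mulr1.
by rewrite k1 (negbTE js) -invr_expz expr1z.
Qed.

Lemma half_tau3E x : half_tau3 x =
  ([ffun i : idx n => if odd i then x.1 i * x.1 (i + 1) * x.1 (i + 2%:R) else (x.1 (i + 1))^-1],
   [ffun i : idx n => if odd i then x.1 i * ((1 + x.2 i) / (x.1 i + x.2 i))
       * ((x.1 (i + 2%:R) + x.2 (i + 2%:R)) / (1 + x.2 (i + 2%:R))) * x.2 (i + 1)
     else x.2 (i + 1) / x.1 (i + 1)]).
Proof.
pose s := [seq (l.*2)%:R : idx n | l <- iota 0 n.+1].
have sE i : (i \in s) = ~~ odd i.
  apply/mapP/idP => [[l _ ->]|oi]; first by rewrite odd_idx_nat odd_double.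
  have li := ltn_ord i.
  exists (i : nat)./2.
    rewrite mem_iota /= add0n ltn_half_double. exact: li.
  rewrite -[i in LHS]natr_Zp; congr (_ %:R).
  by rewrite -[LHS]odd_double_half (negbTE oi).
have us : uniq s.
  rewrite map_inj_in_uniq ?iota_uniq // => a b.
  rewrite !mem_iota !add0n /= => la lb /(congr1 (@nat_of_ord _)).
  rewrite !Zp_nat /= !modn_small; last 2 first.
  - by rewrite -doubleS ltn_double.
  - by rewrite -doubleS ltn_double.
  exact: double_inj.
have -> : half_tau3 x = foldr (fun j y => r j y) (rot1 x) s.
  by rewrite /half_tau3 /s foldr_map.
rewrite fold_rE //; last first.
  by apply/allP => j; rewrite sE.
congr pair; apply/ffunP => i; rewrite !ffunE !sE ?odd_idxE.
  by case: (odd i); rewrite ?subrK -?addrA //; congr (_ * _); rewrite mulrC.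
case: (odd i); rewrite ?subrK -?addrA //.
by rewrite [RHS]mulrC [RHS]mulrA.
Qed.

(* The explicit expressions of tau_3(alpha_i) and tau_3(phi_i). *)
Lemma tau3_alphaE x j : (forall i, x.1 i != 0) -> (tau3 x).1 j =
  if odd j
  then x.1 j * x.1 (j + 1) * x.1 (j + 2%:R) * x.1 (j + 3%:R) * x.1 (j + 4%:R)
  else 1 / (x.1 (j + 1) * x.1 (j + 2%:R) * x.1 (j + 3%:R)).
Proof.
move=> x0; rewrite /tau3 !half_tau3E /= !ffunE !odd_idxE /=.
have -> : j + 1 + 1 = j + 2%:R by ring.
have -> : j + 1 + 2%:R = j + 3%:R by ring.
have -> : j + 2%:R + 1 = j + 3%:R by ring.
have -> : j + 2%:R + 2%:R = j + 4%:R by ring.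
by case: (odd j); rewrite /= ?div1r //; field; rewrite x0.
Qed.

Lemma tau3_phi_even x j : (forall i, x.1 i != 0) -> ~~ odd j ->
  (tau3 x).2 j =
    1 / (x.1 (j + 2%:R) * x.1 (j + 3%:R))
    * (((1 + x.2 (j + 1)) * (x.1 (j + 3%:R) + x.2 (j + 3%:R)))
       / ((1 + x.2 (j + 3%:R)) * (x.1 (j + 1) + x.2 (j + 1))))
    * x.2 (j + 2%:R).
Proof.
move=> x0 /negbTE oj; rewrite /tau3 !half_tau3E /= !ffunE !odd_idxE oj /=.
have -> : j + 1 + 1 = j + 2%:R by ring.
have -> : j + 1 + 2%:R = j + 3%:R by ring.
rewrite [((1 + x.2 (j + 3%:R)) * _)^-1]invfM.
move: (1 + x.2 (j + 3%:R))^-1 (x.1 (j + 1) + x.2 (j + 1))^-1 => u v.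
by field; rewrite !x0.
Qed.

Lemma tau3_phi_odd x j : (forall i, x.1 i != 0) -> odd j ->
  (tau3 x).2 j =
    x.1 j * x.1 (j + 1)
    * (((1 + (tau3 x).2 (j + 1))
          * (1 / (x.1 j * x.1 (j + 1) * x.1 (j + 2%:R)) + (tau3 x).2 (j - 1)))
       / ((1 + (tau3 x).2 (j - 1))
          * (1 / (x.1 (j + 2%:R) * x.1 (j + 3%:R) * x.1 (j + 4%:R))
             + (tau3 x).2 (j + 1))))
    * x.2 (j + 2%:R).
Proof.
move=> x0 oj; set y := half_tau3 x.
have y1 i : odd i -> y.1 i = x.1 i * x.1 (i + 1) * x.1 (i + 2%:R).
  by move=> oi; rewrite /y half_tau3E ffunE oi.
have fE i : odd i -> (tau3 x).2 (i - 1) = y.2 i / y.1 i.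
  by move=> oi; rewrite /tau3 -/y half_tau3E ffunE !odd_idxE oi /= subrK.
have y2 : y.2 (j + 1) = x.2 (j + 2%:R) / x.1 (j + 2%:R).
  by rewrite /y half_tau3E ffunE odd_idxE oj /= -addrA.
have o2 : odd (j + 2%:R)%R by rewrite odd_idxD odd_idx_nat oj.
have e1 : j + 1 = j + 2%:R - 1 by ring.
have -> : (tau3 x).2 (j + 1) = y.2 (j + 2%:R) / y.1 (j + 2%:R) by rewrite e1 fE.
rewrite fE // -y1 //.
have e3 : x.1 (j + 2%:R) * x.1 (j + 3%:R) * x.1 (j + 4%:R) = y.1 (j + 2%:R).
  by rewrite y1 // -!addrA.
have yn i : odd i -> y.1 i != 0 by move=> oi; rewrite y1 // !mulf_neq0.
have a0 : y.1 j != 0 by exact: yn.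
have b0 : y.1 (j + 2%:R) != 0 by exact: yn.
rewrite e3; have -> : x.1 j * x.1 (j + 1) = y.1 j / x.1 (j + 2%:R).
  by rewrite y1 // mulfK.
rewrite /tau3 -/y half_tau3E ffunE oj y2.
have D1 (a b : K) : a != 0 -> 1 + b / a = (a + b) / a by move=> an; field.
have D2 (a b : K) : a != 0 -> 1 / a + b / a = (1 + b) / a by move=> an; field.
rewrite !D1 // !D2 // !invfM !invrK.
move: (y.1 j + y.2 j)^-1 (1 + y.2 (j + 2%:R))^-1 => u v.
by field; rewrite a0 b0 x0.
Qed.

Lemma tau3_c_of_alpha (p s0 s1 : K) x :
  p != 0 -> s0 != 0 -> s1 != 0 -> (forall j, x.1 j != 0) ->
  c_of_alpha (p * s0) (p * s1) (tau3 x).1 = tau3_c p (c_of_alpha s0 s1 x.1).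
Proof.
move=> p0 s00 s10 x0; apply/ffunP => j.
rewrite /tau3 !half_tau3E /= !ffunE !odd_idxE /=.
have a1 : j + 1 + 1 = j + 2%:R by ring.
have a2 : j + 1 + 2%:R = j + 3%:R by ring.
have a3 : j + 2%:R + 1 = j + 3%:R by ring.
have a4 : j + 2%:R + 2%:R = j + 4%:R by ring.
by case: (odd j); rewrite /= ?a1 ?a2 ?a3 ?a4; field; rewrite ?p0 ?s00 ?s10 ?x0.
Qed.

End Facts.

Section Tsuda.
Variables (K : fieldType) (n : nat).

(* phi (t_0, t_1) c is the tuple of the values phi_i(t, c).  At q^a t the
   chosen (n+1)-th root of q^a t_l is p^a s_l.  The first condition says that
   numerators and denominators of the rational expressions involved do not
   vanish. *)
Definition dependent_variables (q p t0 t1 s0 s1 : K) (c : tup K n)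
    (phi : K * K -> tup K n -> tup K n) : Prop :=
  forall a k : int,
    let t0a := q ^ a * t0 in
    let t1a := q ^ a * t1 in
    let ck := tau3_c_exp p k c in
    let al := alpha_of_c (p ^ a * s0) (p ^ a * s1) ck in
    let ph := phi (t0a, t1a) ck in
    [/\ forall j, 1 + ph j != 0 /\ al j + ph j != 0,
        \prod_(j : idx n | ~~ odd j) ph j = t0a^-1,
        \prod_(j : idx n | odd j) ph j
          = t1a^-1 * \prod_(j : idx n | odd j) al j
      & phi (q * t0a, q * t1a) (tau3_c_exp p (k + 1) c) = (tau3 (al, ph)).2].

(* As families of double indices use 'Z_n.+1, they are meant for n >= 1. *)
Notation dfamily := ('Z_n.+1 -> 'Z_n.+1 -> K).

(* The second index n - i + 2k, modulo n+1. *)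
Definition dix (i k : nat) : 'Z_n.+1 := n%:R - i%:R + (2 * k)%:R.

(* f and fb are only constrained at the indices (i, n-i+2k), g and gb at the
   indices (i, n-i+2k-1); for odd n these are half of all the indices, for
   even n they are all indices. *)
Definition tsuda_variables (q p t0 t1 s0 : K) (c : tup K n)
    (phi : K * K -> tup K n -> tup K n) (cc f g fb gb : dfamily) : Prop :=
  forall i k : nat, (i <= n)%N -> (k <= n)%N ->
    let ck := tau3_c_exp p (- k%:Z) c in
    let e : idx n := (2 * i)%:R in
    let o : idx n := (2 * i + 1)%:R in
    let ph := phi (t0, t1) ck in
    let phq := phi (q * t0, q * t1) ck in
    [/\ cc i%:R (dix i k) = ck e / p /\ cc i%:R (dix i k - 1) = (ck o)^-1,
        f i%:R (dix i k) = s0 * ph e,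
        g i%:R (dix i k - 1) = s0^-1 * ph o / ck o,
        fb i%:R (dix i k) = p * s0 * phq e
      & gb i%:R (dix i k - 1) = p^-1 * s0^-1 * phq o / ck o].

Definition tsuda_system (p alpha beta gamma delta : K)
    (cc f g fb gb : dfamily) : Prop :=
  forall i k : nat, (i <= n)%N -> (k <= n)%N ->
    let i0 : 'Z_n.+1 := i%:R in
    let i1 : 'Z_n.+1 := (i + 1)%:R in
    let d := dix i k in
    fb i0 d
      = cc i0 d / cc i0 (d + 1)
        * (((g i1 d - alpha) * (g i0 (d + 1) - cc i0 (d + 1) * beta))
           / ((g i0 (d + 1) - alpha) * (g i1 d - cc i1 d * beta)))
        * f i1 (d + 1)
    /\
    gb i0 (d - 1)
      = cc i1 (d - 1) / cc i1 d
        * (((fb i1 (d - 1) - p * gamma) * (fb i0 d - cc i0 d * delta))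
           / ((fb i0 d - p * gamma) * (fb i1 (d - 1) - cc i1 (d - 1) * delta)))
        * g i1 d.

Definition tsuda_constraints (alpha beta gamma delta : K)
    (cc f g : dfamily) : Prop :=
  [/\ alpha * delta = beta * gamma,
      forall i k : nat, (i <= n)%N -> (k <= n)%N ->
        let i0 : 'Z_n.+1 := i%:R in
        let i1 : 'Z_n.+1 := (i + 1)%:R in
        let d := dix i k in
        (cc i0 d * cc i1 (d + 1)) / (cc i1 d * cc i0 (d + 1)) = 1
        /\ (cc i0 (d - 1) * cc i1 d) / (cc i1 (d - 1) * cc i0 d) = 1,
      forall k : nat, (k <= n)%N ->
        \prod_(0 <= i < n.+1) f i%:R (dix i k) = 1
    & forall k : nat, (k <= n)%N ->
        \prod_(0 <= i < n.+1) g i%:R (dix i k - 1) = 1].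

End Tsuda.

(* Main.v *)
Require Import Defs.
From mathcomp Require Import all_boot all_algebra ring.
Set Implicit Arguments.
Unset Strict Implicit.
Unset Printing Implicit Defensive.
Import GRing.Theory.
Local Open Scope ring_scope.

(** Let σ be the action of r_0 r_2 ⋯ r_{2n} π on c, so that τ_3 = σ². It maps
    c_{2i} to q^{1/(n+1)}/c_{2i+1} and shifts the products c_{2i} c_{2i+1},
    hence σ^{n+1} = 1 because the product of all c_j is q. In these terms
    c_{i,n-i+l} = σ^{-l}(c_{2i})/q^{1/(n+1)} for every l, whatever its parity,
    so that Tsuda's double indices are meaningful modulo n+1. His equations at
    (i, k) are then the formulas for τ_3(φ_{2i}) and τ_3(φ_{2i+1}) at the
    point (t, τ_3^{-k-1}(c)), which τ_3 maps to (qt, τ_3^{-k}(c)). *)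

(** * Indices modulo 2n+2 and products over the even and the odd ones *)

Lemma idx_nat_mod (n k : nat) : ((k %% n.*2.+2)%:R : idx n) = k%:R.
Proof. by apply: val_inj; rewrite /= !Zp_nat /= modn_mod. Qed.

Lemma idx_natMl2_mod (n i : nat) :
  ((2 * (i %% n.+1))%:R : idx n) = (2 * i)%:R.
Proof.
have -> : (2 * (i %% n.+1) = (2 * i) %% n.*2.+2)%N.
  by rewrite muln_modr [(2 * n.+1)%N]mul2n.
exact: idx_nat_mod.
Qed.

Section EvenOddProducts.
Variables (K : fieldType) (n : nat).
Implicit Types F : idx n -> K.

Lemma prod_even_idx F :
  \prod_(j : idx n | ~~ odd j) F j = \prod_(s < n.+1) F (2 * s)%:R.
Proof.
have vE (s : 'I_n.+1) : ((2 * s)%:R : idx n) = (2 * s)%N :> nat.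
  by rewrite Zp_nat /= modn_small // mul2n -doubleS ltn_double.
rewrite (reindex_onto (fun s : 'I_n.+1 => (2 * s)%:R : idx n)
  (fun j => inord j./2)) /=.
  apply: eq_bigl => s; rewrite vE mul2n odd_double doubleK /=.
  by rewrite inord_val eqxx.
move=> j oj; have lj := ltn_ord j; apply: val_inj.
by rewrite /= vE inordK ?mul2n ?ltn_half_double // halfK (negbTE oj) subn0.
Qed.

Lemma prod_odd_idx_shift F :
  \prod_(j : idx n | odd j) F j = \prod_(j : idx n | ~~ odd j) F (j + 1).
Proof.
rewrite (reindex_inj (addIr 1)).
by apply: eq_bigl => j; rewrite odd_idxD odd_idx1 addbT.
Qed.

Lemma prod_odd_idx F :
  \prod_(j : idx n | odd j) F j = \prod_(s < n.+1) F ((2 * s)%:R + 1).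
Proof. by rewrite prod_odd_idx_shift prod_even_idx. Qed.

Lemma prod_idx F :
  \prod_j F j = \prod_(s < n.+1) (F (2 * s)%:R * F ((2 * s)%:R + 1)).
Proof.
rewrite (bigID (fun j : idx n => odd j)) /= mulrC prod_even_idx prod_odd_idx.
by rewrite big_split.
Qed.

(** For even [j0] the map j ↦ [j0 - j] preserves parity, hence permutes the even indices. This
    serves products that run backwards along the cycle. *)
Lemma prod_even_idx_reflect F (j0 : idx n) : ~~ odd j0 ->
  \prod_(s < n.+1) F (j0 - (2 * s)%:R) = \prod_(s < n.+1) F (2 * s)%:R.
Proof.
move=> oj; rewrite -(prod_even_idx (fun j => F (j0 - j))) -prod_even_idx.
rewrite [RHS](reindex_inj (subrI j0)).
by apply: eq_bigl => j; rewrite odd_idxD odd_idxN (negbTE oj).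
Qed.

End EvenOddProducts.

(** * The half step σ^{-1} on c and its period n+1 *)

Section HalfStep.
Variables (K : fieldType) (n : nat) (p : K).
Hypothesis p0 : p != 0.
Implicit Types (c : tup K n) (j : idx n).

(* The inverse of the action on c of half_tau3 = r_0 r_2 ... r_{2n} pi. *)
Definition half_cV c : tup K n :=
  [ffun j : idx n => if odd j then p / c (j - 1)
                     else p^-1 * (c j * c (j - 1) * c (j - 2%:R))].

Lemma half_cV_neq0 c : (forall j, c j != 0) -> forall j, half_cV c j != 0.
Proof.
by move=> c0 j; rewrite ffunE; case: ifP => _; rewrite !mulf_neq0 ?invr_eq0.
Qed.

Lemma iter_half_cV_neq0 l c :
  (forall j, c j != 0) -> forall j, iter l half_cV c j != 0.
Proof. by move=> c0; elim: l => //= l IH; exact: half_cV_neq0. Qed.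

Lemma half_cV2 c : (forall j, c j != 0) -> half_cV (half_cV c) = tau3_cV p c.
Proof.
move=> c0; apply/ffunP => j; rewrite !ffunE !odd_idxE.
have -> : j - 1 - 1 = j - 2%:R by ring.
have -> : j - 1 - 2%:R = j - 3%:R by ring.
have -> : j - 2%:R - 1 = j - 3%:R by ring.
have -> : j - 2%:R - 2%:R = j - 4%:R by ring.
by case: (odd j) => /=; field; rewrite ?p0 ?c0.
Qed.

Lemma iter_tau3_cV k c : (forall j, c j != 0) ->
  iter k (tau3_cV p) c = iter (2 * k) half_cV c.
Proof.
move=> c0; elim: k => // k IH; rewrite mulnS iterS IH -half_cV2 //.
exact: iter_half_cV_neq0.
Qed.

(* The products c_{2i} c_{2i+1} are merely shifted, and each step multiplies
   c_{2i} by one of them, divided by p. *)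
Lemma iter_half_cVE l c : (forall j, c j != 0) ->
  forall j, ~~ odd j ->
  iter l half_cV c j * iter l half_cV c (j + 1)
    = c (j - (2 * l)%:R) * c (j - (2 * l)%:R + 1) /\
  iter l half_cV c j = c j *
    \prod_(s < l) (p^-1 * (c (j - (2 * s.+1)%:R) * c (j - (2 * s.+1)%:R + 1))).
Proof.
move=> c0; elim: l => [|l IH] j oj; first by rewrite muln0 subr0 big_ord0 mulr1.
have o2 : ~~ odd (j - 2%:R)%R by rewrite !odd_idxE addbF.
have [/= H1 _] := IH _ o2; have [_ H2] := IH _ oj.
have jE : j - 2%:R + 1 = j - 1 by ring.
have lE : j - 2%:R - (2 * l)%:R = j - (2 * l.+1)%:R.
  by rewrite mulnS natrD; ring.
rewrite jE lE in H1.
have E0 : half_cV (iter l half_cV c) j = iter l half_cV c j *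
    (p^-1 * (c (j - (2 * l.+1)%:R) * c (j - (2 * l.+1)%:R + 1))).
  by rewrite ffunE (negbTE oj) -H1; ring.
have N := iter_half_cV_neq0 l c0 j.
rewrite big_ord_recr /= mulrA -H2; split=> //.
rewrite E0 [half_cV _ (j + 1)]ffunE odd_idxD odd_idx1 (negbTE oj) /= addrK.
by field; rewrite p0 N.
Qed.

(** Over [n.+1] steps an even entry picks up p^{-1} times each pair product c_{2i} c_{2i+1} exactly
    once, and these factors multiply to 1. The pair products themselves have been shifted by a full
    turn 2n+2, so the odd entries return as well. *)
Lemma half_cV_period c : (forall j, c j != 0) -> \prod_j c j = p ^+ n.+1 ->
  iter n.+1 half_cV c = c.
Proof.
move=> c0 pc.
have E j : ~~ odd j -> iter n.+1 half_cV c j = c j.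
  move=> oj; rewrite (proj2 (iter_half_cVE n.+1 c0 oj)).
  have o2 : ~~ odd (j - 2%:R)%R by rewrite !odd_idxE addbF.
  rewrite big_split /= prodr_const card_ord.
  (* The pairs sit at j - 2(s+1) = (j-2) - 2s, so reflection in the even index j - 2 turns this into
     a product over all pairs. *)
  have -> : \prod_(s < n.+1) (c (j - (2 * s.+1)%:R) * c (j - (2 * s.+1)%:R + 1))
          = \prod_j c j.
    rewrite prod_idx -(prod_even_idx_reflect (fun i => c i * c (i + 1)) o2).
    by apply: eq_bigr => s _; rewrite mulnS natrD opprD addrA.
  by rewrite pc exprVn mulVf ?mulr1 // expf_neq0.
apply/ffunP => j; case: (boolP (odd j)) => [oj|/E //].
have oj1 : ~~ odd (j - 1)%R by rewrite !odd_idxE oj.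
have [H _] := iter_half_cVE n.+1 c0 oj1; rewrite E // subrK in H.
have N2 : (2 * n.+1)%:R = 0 :> idx n.
  by rewrite -(idx_nat_mod n) mul2n modnn.
rewrite N2 subr0 subrK in H.
exact: (mulfI (c0 (j - 1)) H).
Qed.

Lemma iter_half_cV_mod l c : (forall j, c j != 0) -> \prod_j c j = p ^+ n.+1 ->
  iter (l %% n.+1) half_cV c = iter l half_cV c.
Proof.
move=> c0 pc; rewrite [in RHS](divn_eq l n.+1) addnC iterD.
congr iter; elim: (_ %/ _)%N => // m IH.
by rewrite mulSn addnC iterD half_cV_period.
Qed.

End HalfStep.

(** * Negative powers of τ_3 and products of the α_j *)

Lemma tau3_c_exp_neg (K : fieldType) (n : nat) (p : K) (k : nat) (c : tup K n) :
  tau3_c_exp p (- k%:Z) c = iter k (tau3_cV p) c.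
Proof. by case: k. Qed.

(** The factors s0 s1 and their inverses cancel between an even index and the odd one after it. This
    turns the definition of q into the product of all c_j. *)
Lemma prod_alpha_of_c (K : fieldType) (n : nat) (s0 s1 : K) (c : tup K n) :
  s0 != 0 -> s1 != 0 -> \prod_j alpha_of_c s0 s1 c j = \prod_j c j.
Proof.
move=> s00 s10; rewrite !prod_idx; apply: eq_bigr => s _.
rewrite !ffunE odd_idxD odd_idx1 odd_idx_nat mul2n odd_double /=.
by field; rewrite s00 s10.
Qed.

Lemma prod_odd_alpha_of_c (K : fieldType) (n : nat) (s0 s1 : K) (c : tup K n) :
  \prod_(j : idx n | odd j) alpha_of_c s0 s1 c j
    = s0 ^+ n.+1 * s1 ^+ n.+1 * \prod_(j : idx n | odd j) c j.
Proof.
rewrite !prod_odd_idx -exprMn -[X in _ ^+ X]card_ord -prodr_const -big_split /=.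
apply: eq_bigr => s _.
by rewrite !ffunE odd_idxD odd_idx1 odd_idx_nat mul2n odd_double.
Qed.

(** * Tsuda's two equations as identities of rational functions *)

Section TsudaIdentities.
Variables (K : fieldType) (p s0 s1 : K).
Hypotheses (p0 : p != 0) (s00 : s0 != 0) (s10 : s1 != 0).

(** Here [dm] and [xm] stand for the values of c_{2i+m} and φ_{2i+m} at (t, τ_3^{-k-1}(c)). Each
    linear factor in g is α_{2i+m} + φ_{2i+m} or 1 + φ_{2i+m} divided by [s0 * dm], and these
    denominators cancel in the quotient. *)
Lemma tsuda_f_identity (d1 d2 d3 x1 x2 x3 : K) :
  d1 != 0 -> d2 != 0 -> d3 != 0 -> 1 + x3 != 0 ->
  s0 * s1 * d1 + x1 != 0 ->
  p * s0 * (1 / (s0^-1 * s1^-1 * d2 * (s0 * s1 * d3))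
    * (((1 + x1) * (s0 * s1 * d3 + x3)) / ((1 + x3) * (s0 * s1 * d1 + x1)))
    * x2)
  = p ^+ 2 / (d1 * d2 * d3) / p / d1^-1
    * (((s0^-1 * x3 / d3 - - s1) * (s0^-1 * x1 / d1 - d1^-1 * - s0^-1))
       / ((s0^-1 * x1 / d1 - - s1) * (s0^-1 * x3 / d3 - d3^-1 * - s0^-1)))
    * (s0 * x2).
Proof.
move=> d10 d20 d30 h3 h1'.
have E (d x : K) : d != 0 -> s0^-1 * x / d - - s1 = (s0 * s1 * d + x) / (s0 * d).
  by move=> dn; field; rewrite s00 dn.
have E' (d x : K) : d != 0 ->
    s0^-1 * x / d - d^-1 * - s0^-1 = (1 + x) / (s0 * d).
  by move=> dn; field; rewrite s00 dn.
rewrite !E // !E' //.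
by field; rewrite p0 s00 s10 d10 d20 d30 h1' h3 oner_neq0.
Qed.

(** Here [x0], [x2] are values of φ at (qt, τ_3^{-k}(c)), while [x3] and the [dm] belong to (t,
    τ_3^{-k-1}(c)). The reciprocal of three consecutive α is τ_3(α_{2i}), that is, α_{2i} recovered
    from c with the roots p s0 and p s1 of qt. *)
Lemma tsuda_g_identity (d1 d2 d3 d4 d5 x0 x2 x3 : K) :
  let c0 := p ^+ 2 / (d1 * d2 * d3) in
  let c2 := p ^+ 2 / (d3 * d4 * d5) in
  d1 != 0 -> d2 != 0 -> d3 != 0 -> d4 != 0 -> d5 != 0 -> 1 + x0 != 0 ->
  (p * s0)^-1 * (p * s1)^-1 * c2 + x2 != 0 ->
  p^-1 * s0^-1
    * (s0 * s1 * d1 * (s0^-1 * s1^-1 * d2)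
       * (((1 + x2)
           * (1 / (s0 * s1 * d1 * (s0^-1 * s1^-1 * d2) * (s0 * s1 * d3)) + x0))
          / ((1 + x0)
           * (1 / (s0 * s1 * d3 * (s0^-1 * s1^-1 * d4) * (s0 * s1 * d5)) + x2)))
       * x3)
    / (p ^- 2 * (d1 * d2 * d3 * d4 * d5))
  = c2 / p / d3^-1
    * (((p * s0 * x2 - p * - s0) * (p * s0 * x0 - c0 / p * - s1^-1))
       / ((p * s0 * x0 - p * - s0) * (p * s0 * x2 - c2 / p * - s1^-1)))
    * (s0^-1 * x3 / d3).
Proof.
move=> c0 c2 d10 d20 d30 d40 d50 h0.
have E (a b d : K) : a != 0 -> b != 0 -> d != 0 ->
    1 / (s0 * s1 * a * (s0^-1 * s1^-1 * b) * (s0 * s1 * d))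
    = (p * s0)^-1 * (p * s1)^-1 * (p ^+ 2 / (a * b * d)).
  by move=> an bn dn; field; rewrite p0 s00 s10 an bn dn.
rewrite !E // -/c0 -/c2.
have E' (c x : K) : p * s0 * x - c / p * - s1^-1
    = p * s0 * ((p * s0)^-1 * (p * s1)^-1 * c + x).
  by field; rewrite p0 s00 s10.
have E'' (x : K) : p * s0 * x - p * - s0 = p * s0 * (1 + x) by ring.
rewrite !E' !E'' {E E' E''}.
(* These sums become atoms for [field], since the denominator is known to be nonzero only as a
   whole. *)
move: (_ * c0 + x0) (_ * c2 + x2) => u v v0; rewrite /c2.
by field; rewrite p0 s00 s10 d10 d20 d30 d40 d50 h0 v0 oner_neq0.
Qed.

End TsudaIdentities.

(** * Arithmetic of the double indices modulo n+1 *)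

Lemma natr_Zp_mod (n : nat) (hn : (1 <= n)%N) (i : nat) :
  ((i %% n.+1)%:R : 'Z_n.+1) = i%:R.
Proof.
(* ['Z_n.+1] has modulus n+1 only for n >= 1; after the case analysis the modulus computes. *)
by case: n hn => // n _; apply: val_inj; rewrite /= !Zp_nat /= modn_mod.
Qed.

Lemma val_natr_Zp (n : nat) (hn : (1 <= n)%N) (l : nat) :
  nat_of_ord (l%:R : 'Z_n.+1) = (l %% n.+1)%N.
Proof. by case: n hn => // n _; rewrite Zp_nat. Qed.

Lemma dix_mod (n : nat) (hn : (1 <= n)%N) (i k : nat) :
  dix n (i %% n.+1) (k %% n.+1) = dix n i k.
Proof. by rewrite /dix !natrM !natr_Zp_mod. Qed.

Lemma dixSS (n i k : nat) : dix n i.+1 k.+1 = dix n i k + 1.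
Proof. by rewrite /dix mulnS natrD -[i.+1%:R]natr1; ring. Qed.

Lemma dixS (n i k : nat) : dix n i.+1 k = dix n i k - 1.
Proof. by rewrite /dix -[i.+1%:R]natr1; ring. Qed.

Lemma dix_subr1 (n i k : nat) : dix n i k.+1 - 1 = dix n i k + 1.
Proof. by rewrite -dixS dixSS. Qed.

Definition iter_cV (K : fieldType) (n : nat) (p : K) (c : tup K n) (k : nat) :
  tup K n := iter k (tau3_cV p) c.

(** * Tsuda's variables as well-defined families modulo n+1 *)

Section Periodicity.
Variables (K : fieldType) (n : nat) (q p t0 t1 s0 : K) (c : tup K n).
Variable phi : K * K -> tup K n -> tup K n.
Hypotheses (hn : (1 <= n)%N) (p0 : p != 0) (c0 : forall j, c j != 0).
Hypothesis pc : \prod_j c j = p ^+ n.+1.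

Let C : nat -> tup K n := iter_cV p c.

Lemma iter_tau3_cV_mod k : C (k %% n.+1) = C k.
Proof.
rewrite /C /iter_cV !iter_tau3_cV // -(iter_half_cV_mod p0 (2 * (k %% n.+1))) //.
by rewrite modnMmr iter_half_cV_mod.
Qed.

Lemma tsuda_variables_periodic cc f g fb gb :
  tsuda_variables q p t0 t1 s0 c phi cc f g fb gb ->
  forall i k (j := (2 * i)%:R : idx n) (d := dix n i k),
    [/\ cc i%:R d = C k j / p /\ cc i%:R (d - 1) = (C k (j + 1))^-1,
        f i%:R d = s0 * phi (t0, t1) (C k) j,
        g i%:R (d - 1) = s0^-1 * phi (t0, t1) (C k) (j + 1) / C k (j + 1),
        fb i%:R d = p * s0 * phi (q * t0, q * t1) (C k) j
      & gb i%:R (d - 1)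
          = p^-1 * s0^-1 * phi (q * t0, q * t1) (C k) (j + 1) / C k (j + 1)].
Proof.
move=> H i k j d.
have le_mod m : (m %% n.+1 <= n)%N by rewrite -ltnS ltn_mod.
have := H _ _ (le_mod i) (le_mod k).
rewrite tau3_c_exp_neg -/(iter_cV p c _) -/C iter_tau3_cV_mod.
by rewrite dix_mod // natr_Zp_mod // natrD idx_natMl2_mod.
Qed.

(** Distinct pairs (i, k) may share a double index, so the prescribed values must agree. They do
    because (a, b) determines the power l = b - n + a of σ^{-1} modulo n+1, through which every
    family is defined. *)
Lemma tsuda_variables_exist : exists cc f g fb gb,
  tsuda_variables q p t0 t1 s0 c phi cc f g fb gb.
Proof.
pose T (l : 'Z_n.+1) := iter l (half_cV p) c.
pose L (a b : 'Z_n.+1) : 'Z_n.+1 := b - n%:R + a.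
pose E (a : 'Z_n.+1) : idx n := (2 * a)%:R.
exists (fun a b => T (L a b) (E a) / p),
  (fun a b => s0 * phi (t0, t1) (T (L a b)) (E a)),
  (* At the indices of g one has l = 2k - 1, so one more half step reaches τ_3^{-k}(c). *)
  (fun a b => s0^-1 * phi (t0, t1) (T (L a b + 1)) (E a + 1)
              / T (L a b + 1) (E a + 1)),
  (fun a b => p * s0 * phi (q * t0, q * t1) (T (L a b)) (E a)),
  (fun a b => p^-1 * s0^-1 * phi (q * t0, q * t1) (T (L a b + 1)) (E a + 1)
              / T (L a b + 1) (E a + 1)).
move=> i k hi hk /=; rewrite tau3_c_exp_neg -/(iter_cV p c k) -/C.
have L0 : L i%:R (dix n i k) = (2 * k)%:R by rewrite /L /dix; ring.
have L1 : L i%:R (dix n i k - 1) = (2 * k)%:R - 1 by rewrite /L /dix; ring.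
(* Modulo n+1, 2k - 1 is n + 2k, a natural number of iterations. *)
have L2 : L i%:R (dix n i k - 1) = (n + 2 * k)%:R.
  have N : n.+1%:R = 0 :> 'Z_n.+1 by rewrite -(natr_Zp_mod hn) modnn.
  by rewrite L1 natrD; apply/eqP; rewrite subr_eq addrAC natr1 N add0r.
have TE l : T l%:R = iter l (half_cV p) c.
  by rewrite /T val_natr_Zp // iter_half_cV_mod.
have T0 : T (2 * k)%:R = C k by rewrite TE /C /iter_cV iter_tau3_cV.
have Ei : E i%:R = (2 * i)%:R by rewrite /E val_natr_Zp // modn_small.
rewrite L0 T0 L1 subrK T0 -L1 L2 TE Ei natrD; split=> //; split=> //.
(* One further step completes a period, and its odd entries are p over the preceding even ones;
   hence the value 1/τ_3^{-k}(c_{2i+1}). *)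
have back : half_cV p (iter (n + 2 * k) (half_cV p) c) = C k.
  rewrite /C /iter_cV iter_tau3_cV // -iterS -addSn addnC iterD.
  by rewrite half_cV_period.
rewrite -back ffunE odd_idxD odd_idx1 odd_idx_nat oddM /= addrK.
by rewrite invf_div.
Qed.

End Periodicity.

(** * Derivation of Tsuda's system and of its constraints *)

Theorem theorem7p1 (K : fieldType) (n : nat) (hn : (1 <= n)%N)
    (q p t0 t1 s0 s1 : K) (c : tup K n)
    (phi : K * K -> tup K n -> tup K n)
    (hp : p ^+ n.+1 = q) (hs0 : s0 ^+ n.+1 = t0) (hs1 : s1 ^+ n.+1 = t1)
    (ht0 : t0 != 0) (ht1 : t1 != 0) (hc : forall j, c j != 0)
    (hq : q = \prod_j alpha_of_c s0 s1 c j)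
    (hphi : dependent_variables q p t0 t1 s0 s1 c phi) :
  let alpha := - s1 in
  let beta := - s0^-1 in
  let gamma := - s0 in
  let delta := - s1^-1 in
  (exists cc f g fb gb : 'Z_n.+1 -> 'Z_n.+1 -> K,
     tsuda_variables q p t0 t1 s0 c phi cc f g fb gb)
  /\ (forall cc f g fb gb : 'Z_n.+1 -> 'Z_n.+1 -> K,
        tsuda_variables q p t0 t1 s0 c phi cc f g fb gb ->
        tsuda_system p alpha beta gamma delta cc f g fb gb
        /\ tsuda_constraints alpha beta gamma delta cc f g).
Proof.
move=> alpha beta gamma delta.
have s00 : s0 != 0 by move: ht0; rewrite -hs0 expf_eq0.
have s10 : s1 != 0 by move: ht1; rewrite -hs1 expf_eq0.
have pc : \prod_j c j = p ^+ n.+1 by rewrite hp hq prod_alpha_of_c.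
have p0 : p != 0.
  have : p ^+ n.+1 != 0 by rewrite -pc; apply/prodf_neq0.
  by rewrite expf_eq0.
split; first exact: tsuda_variables_exist.
move=> cc f g fb gb /(tsuda_variables_periodic hn p0 hc pc) H.
set C := iter_cV p c in H.
have expE k : tau3_c_exp p (- k%:Z) c = C k by rewrite tau3_c_exp_neg.
have C0 k j : C k j != 0.
  by rewrite /C /iter_cV iter_tau3_cV ?iter_half_cV_neq0.
have CD k : C k = tau3_c p (C k.+1) by rewrite tau3_cVK.
clearbody C.
pose A k := alpha_of_c s0 s1 (C k).
have A0 k j : A k j != 0.
  by rewrite ffunE; case: ifP => _; rewrite !mulf_neq0 ?invr_eq0.
have AE k (j : idx n) : ~~ odd j -> A k j = s0^-1 * s1^-1 * C k j.
  by move=> ej; rewrite ffunE (negbTE ej).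
have AO k (j : idx n) : odd j -> A k j = s0 * s1 * C k j.
  by move=> oj; rewrite ffunE oj.
have P0 k : [/\ forall j, 1 + phi (t0, t1) (C k) j != 0 /\
                  A k j + phi (t0, t1) (C k) j != 0,
    \prod_(j : idx n | ~~ odd j) phi (t0, t1) (C k) j = t0^-1 &
    \prod_(j : idx n | odd j) phi (t0, t1) (C k) j
      = t1^-1 * \prod_(j : idx n | odd j) A k j].
  by have := hphi 0 (- k%:Z); rewrite expE !expr0z !mul1r; case.
have Pq k j : 1 + phi (q * t0, q * t1) (C k) j != 0 /\
    alpha_of_c (p * s0) (p * s1) (C k) j + phi (q * t0, q * t1) (C k) j != 0.
  by have := hphi 1 (- k%:Z); rewrite expE !expr1z; case.
have E k : phi (q * t0, q * t1) (C k)
    = (tau3 (A k.+1, phi (t0, t1) (C k.+1))).2.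
  have := hphi 0 (- k.+1%:Z); rewrite expE !expr0z !mul1r => -[_ _ _].
  have -> : - k.+1%:Z + 1 = - k%:Z by rewrite intS; ring.
  by rewrite expE.
have ej i : ~~ odd ((2 * i)%:R : idx n) by rewrite odd_idx_nat oddM.
have jS i : (2 * i.+1)%:R = (2 * i)%:R + 2%:R :> idx n.
  by rewrite mulnS natrD addrC.
have jD (a b : nat) (j : idx n) : j + a%:R + b%:R = j + (a + b)%:R.
  by rewrite natrD addrA.
(* Entries at level k are expressed through level k+1, where the formulas for τ_3 are evaluated. *)
have CE k (j : idx n) : ~~ odd j -> C k j
    = p ^+ 2 / (C k.+1 (j + 1) * C k.+1 (j + 2%:R) * C k.+1 (j + 3%:R)).
  by move=> jE; rewrite CD ffunE (negbTE jE).
have CE2 k (j : idx n) : ~~ odd j -> C k (j + 2%:R)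
    = p ^+ 2 / (C k.+1 (j + 3%:R) * C k.+1 (j + 4%:R) * C k.+1 (j + 5%:R)).
  by move=> jE; rewrite CE ?odd_idxE ?addbF // (jD 2%N 1%N) !jD.
have CO k (j : idx n) : ~~ odd j -> C k (j + 1)
    = p ^- 2 * (C k.+1 (j + 1) * C k.+1 (j + 2%:R) * C k.+1 (j + 3%:R)
                * C k.+1 (j + 4%:R) * C k.+1 (j + 5%:R)).
  move=> jE; rewrite CD ffunE odd_idxD odd_idx1 (negbTE jE) /=.
  by rewrite (jD 1%N 1%N) !(jD 1%N).
(* The double index (i, d+1) is the odd one of (i, k+1), (i+1, d-1) the even one of (i+1, k), while
   (i+1, d) and (i+1, d+1) are the odd and the even one of (i+1, k+1). *)
have ccE i k (j := (2 * i)%:R : idx n) (d := dix n i k) :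
    [/\ cc i%:R d = C k j / p /\ cc i%:R (d - 1) = (C k (j + 1))^-1,
        cc i%:R (d + 1) = (C k.+1 (j + 1))^-1,
        cc i.+1%:R (d - 1) = C k (j + 2%:R) / p,
        cc i.+1%:R d = (C k.+1 (j + 3%:R))^-1
      & cc i.+1%:R (d + 1) = C k.+1 (j + 2%:R) / p].
  have [c12 _ _ _ _] := H i k.
  have [[_ c3] _ _ _ _] := H i k.+1.
  have [[c4 _] _ _ _ _] := H i.+1 k.
  have [[c6 c5] _ _ _ _] := H i.+1 k.+1.
  rewrite dix_subr1 in c3; rewrite dixS jS in c4.
  by rewrite dixSS jS addrK (jD 2%N 1%N) in c5 c6.
split.
  move=> i k _ _ i0 i1 d; rewrite /i1 addn1 {i1}.
  have [[c1 _] c2 c3 c4 _] := ccE i k.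
  have [_ _ _ fb1 gb1] := H i k.
  have [_ _ g2 _ _] := H i k.+1.
  have [_ _ _ fb3 _] := H i.+1 k.
  have [_ f4 g4 _ _] := H i.+1 k.+1.
  rewrite dix_subr1 in g2; rewrite dixS in fb3.
  rewrite dixSS addrK in g4; rewrite dixSS in f4.
  rewrite jS (jD 2%N 1%N) -[(2 + 1)%N]/3%N in fb3 f4 g4.
  rewrite c1 c2 c3 c4 f4 g2 g4 fb1 fb3 gb1.
  move: (ej i) => {c1 c2 c3 c4 f4 g2 g4 fb1 fb3 gb1}.
  move: ((2 * i)%:R : idx n) => j jE.
  have [nz _ _] := P0 k.+1; have nzq := Pq k.
  have jO (b : nat) : odd b -> odd (j + b%:R : idx n)%R.
    by move=> ob; rewrite !odd_idxE (negbTE jE).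
  have [j1O j3O j5O] := And3 (jO 1%N isT) (jO 3%N isT) (jO 5%N isT).
  have j2E : ~~ odd (j + 2%:R : idx n)%R by rewrite !odd_idxE addbF.
  have j4E : ~~ odd (j + 4%:R : idx n)%R by rewrite !odd_idxE addbF.
  split.
    have [_ h1] := nz (j + 1); have [h3 _] := nz (j + 3%:R).
    rewrite AO // in h1.
    rewrite E tau3_phi_even //= [A _ (j + 2%:R)]AE // !AO // (CE k j) //.
    exact: tsuda_f_identity.
  have [h0 _] := nzq j; have [_ h2] := nzq (j + 2%:R).
  rewrite ffunE (negbTE j2E) CE2 // in h2.
  (* Only the left side is expanded; the inner τ_3(φ) are then folded back into φ at qt, to match
     the barred f on the right. *)
  rewrite [in LHS]E tau3_phi_odd //; last exact: A0.
  set T := (tau3 _).2; have -> : T = phi (q * t0, q * t1) (C k) by rewrite E.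
  rewrite addrK /= {T}.
  rewrite (jD 1%N 1%N) !(jD 1%N) -[(1 + 1)%N]/2%N.
  rewrite [A _ (j + 2%:R)]AE // [A _ (j + 4%:R)]AE // !AO // (CO k j) //.
  rewrite (CE2 k j) // (CE k j) //.
  exact: tsuda_g_identity.
split.
- by rewrite /alpha /beta /gamma /delta; field; rewrite s00 s10.
- move=> i k _ _ i0 i1 d; rewrite /i1 addn1 {i1}.
  have [[c1 c2] c3 c4 c5 c6] := ccE i k; have jE := ej i.
  rewrite c1 c2 c3 c4 c5 c6 (CO k _ jE) (CE2 k _ jE) (CE k _ jE).
  by split; field; rewrite p0 !C0 ?oner_neq0.
- move=> k _; rewrite big_mkord.
  under eq_bigr => i _.
    have [_ -> _ _ _] := H i k.
    over.
  rewrite big_split prodr_const card_ord -prod_even_idx /=.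
  by have [_ -> _] := P0 k; rewrite hs0 divff.
- move=> k _; rewrite big_mkord.
  under eq_bigr => i _.
    have [_ _ -> _ _] := H i k.
    over.
  have [_ _ Pk] := P0 k.
  rewrite !big_split prodr_const card_ord prodfV /= -!prod_odd_idx.
  (* The product of the odd α contributes t0 t1, which cancels t1^{-1} and s0^{-(n+1)}; its
     remaining factor cancels the denominators c. *)
  rewrite Pk prod_odd_alpha_of_c hs0 hs1.
  have PC : \prod_(j : idx n | odd j) C k j != 0 by apply/prodf_neq0.
  by rewrite exprVn hs0; field; rewrite ht0 ht1 PC.
Qed.
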